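(* Let $k^\circ\subset k$ be a field extension, let $q\in k\setminus k^\circ$ be transcendental over $k^\circ$, and let $R=k^\circ[q,q^{-1}]\subset k$. Let $A \xrightarrow{\phi} B \xrightarrow{\psi} C$ be a complex of $R$-modules (so $\psi\circ\phi=0$), such that $C$ is torsionfree. Suppose that there are $R$-module decompositions $$A=\bigoplus_{j\in J}A_j,\qquad B=\bigoplus_{j\in J}B_j,\qquad C=\bigoplus_{j\in J}C_j$$ (indexed by a common set $J$) such that $B_j$ is finitely generated, $\phi(A_j)\subseteq B_j$, and $\psi(B_j)\subseteq C_j$ for all $j\in J$. If the reduced complex $\overline{A}\xrightarrow{\overline{\phi}}\overline{B}\xrightarrow{\overline{\psi}}\overline{C}$ is exact (at $\overline{B}$), then so is the complex $$k\otimes_R A\xrightarrow{\ \mathrm{id}\otimes\phi\ }k\otimes_R B\xrightarrow{\ \mathrm{id}\otimes\psi\ }k\otimes_R C$$ (at $k\otimes_R B$).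
   Context: The field $k$ may have arbitrary characteristic and need not be algebraically closed. Since $q$ is transcendental over $k^\circ$, $R=k^\circ[q,q^{-1}]$ is a Laurent polynomial ring, and $k$ is an $R$-module via the inclusion $R\subset k$. Overbars denote reduction modulo $q-1$: for an $R$-module $A$, $\overline{A}=A/(q-1)A$, and for an $R$-module homomorphism $\phi:A\to B$, $\overline{\phi}:\overline{A}\to\overline{B}$ is the induced map $A/(q-1)A\to B/(q-1)B$. *)

(* Defs.v *)
From HB Require Import structures.
From mathcomp Require Import all_boot all_algebra.
From mathcomp Require Import boolp classical_sets cardinality fsbigop.
From mathcomp Require Import generic_quotient ring_quotient freeg.

Set Implicit Arguments.
Unset Strict Implicit.
Unset Printing Implicit Defensive.

Import GRing.Theory.
Local Open Scope ring_scope.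
Local Open Scope quotient_scope.

(* k°[q, q^-1] as a subring of k, the extension k° ⊂ k being given by iota.
   The values p(q) / q^n form a subring even for q = 0 (where 0^-1 = 0), so
   no hypothesis on q is needed to define it. *)
Section LaurentRing.
Context (k0 k : fieldType) (iota : {rmorphism k0 -> k}) (q : k).

Definition laurent_pred : {pred k} := fun x =>
  `[< exists (p : {poly k0}) (n : nat), x = (map_poly iota p).[q] / q ^+ n >].

Lemma laurent_pred_subring : subring_closed laurent_pred.
Proof.
have [q0|qN0] := eqVneq q 0.
  have const x : (x \in laurent_pred) -> exists a, x = iota a.
    move=> /asboolP[p [[|n]]] ->; rewrite q0.
      by exists p.[0]; rewrite -{1}(rmorph0 iota) horner_map expr0 divr1.
    by exists 0; rewrite exprS mul0r invr0 mulr0 rmorph0.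
  have mem a : iota a \in laurent_pred.
    by apply/asboolP; exists a%:P, 0; rewrite map_polyC hornerC expr0 divr1.
  split=> [|x y /const[a ->] /const[b ->]|x y /const[a ->] /const[b ->]].
  - by rewrite -(rmorph1 iota).
  - by rewrite -rmorphB.
  - by rewrite -rmorphM.
have qXN0 n : q ^+ n != 0 by rewrite expf_neq0.
have hornerX n p :
    (map_poly iota (p * 'X^n)).[q] = (map_poly iota p).[q] * q ^+ n.
  by rewrite rmorphM /= map_polyXn hornerM hornerXn.
split=> [|x y /asboolP[p [m ->]] /asboolP[r [n ->]]
         |x y /asboolP[p [m ->]] /asboolP[r [n ->]]]; apply/asboolP.
- by exists 1, 0; rewrite rmorph1 hornerC expr0 divr1.
- exists (p * 'X^n - r * 'X^m), (m + n)%N.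
  rewrite rmorphB /= hornerD hornerN !hornerX exprD.
  apply: (mulIf (mulf_neq0 (qXN0 m) (qXN0 n))); rewrite divfK ?mulf_neq0 //.
  by rewrite mulrBl mulrA divfK // [q ^+ m * _]mulrC mulrA divfK.
- exists (p * r), (m + n)%N.
  by rewrite rmorphM hornerM exprD invfM mulrACA.
Qed.

HB.instance Definition _ :=
  GRing.isSubringClosed.Build k laurent_pred laurent_pred_subring.

Definition laurent : Type := {x : k | x \in laurent_pred}.
HB.instance Definition _ := [isSub of laurent for @sval _ _].
HB.instance Definition _ := [Choice of laurent by <:].
HB.instance Definition _ := [SubChoice_isSubComNzRing of laurent by <:].

Lemma laurent_q_subproof : q \in laurent_pred.
Proof.
by apply/asboolP; exists 'X, 0; rewrite map_polyX hornerX expr0 divr1.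
Qed.

Definition laurent_q : laurent := Sub q laurent_q_subproof.

End LaurentRing.

(* k regarded as a module over its subring [laurent iota q]; iota and q are
   recorded in the type so that this scalar ring can be inferred *)
Definition scalar_ext (k0 k : fieldType) (iota : {rmorphism k0 -> k})
  (q : k) : Type := k.

Section ScalarExtension.
Context (k0 k : fieldType) (iota : {rmorphism k0 -> k}) (q : k).

Local Notation laurent := (laurent iota q).
Local Notation scalar_ext := (scalar_ext iota q).

HB.instance Definition _ := GRing.Zmodule.on scalar_ext.

Definition scalar_ext_scale (r : laurent) (x : scalar_ext) : scalar_ext :=
  (val r : k) * (x : k).

Lemma scalar_ext_scaleA a b v :
  scalar_ext_scale a (scalar_ext_scale b v) = scalar_ext_scale (a * b) v.
Proof. by rewrite /scalar_ext_scale mulrA rmorphM. Qed.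

Lemma scalar_ext_scale1 : left_id 1 scalar_ext_scale.
Proof. by move=> v; rewrite /scalar_ext_scale rmorph1 mul1r. Qed.

Lemma scalar_ext_scaleDr : right_distributive scalar_ext_scale +%R.
Proof. by move=> a u v; rewrite /scalar_ext_scale mulrDr. Qed.

Lemma scalar_ext_scaleDl v : {morph scalar_ext_scale^~ v : a b / a + b}.
Proof. by move=> a b; rewrite /scalar_ext_scale rmorphD mulrDl. Qed.

HB.instance Definition _ := GRing.Zmodule_isLmodule.Build laurent scalar_ext
  scalar_ext_scaleA scalar_ext_scale1 scalar_ext_scaleDr scalar_ext_scaleDl.

End ScalarExtension.

Section QuotientModule.
Context (R : nzRingType) (M : lmodType R) (S : submodClosed M).

(* MathComp does not derive zmodClosed from submodClosed *)
Definition submod_zmod_pred : {pred M} := S.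
HB.instance Definition _ := GRing.isZmodClosed.Build M submod_zmod_pred
  (GRing.submod_closedB (submodClosedP S)).

Definition quotmod : Type := Quotient.quot submod_zmod_pred.
HB.instance Definition _ := GRing.Zmodule.on quotmod.

Definition quotmod_pi (x : M) : quotmod :=
  \pi_(Quotient.quot submod_zmod_pred) x.
Definition quotmod_repr (x : quotmod) : M :=
  repr (x : Quotient.quot submod_zmod_pred).

Lemma quotmod_reprK : cancel quotmod_repr quotmod_pi.
Proof. exact: reprK. Qed.

Lemma quotmod_eqP x y : reflect (quotmod_pi x = quotmod_pi y) (x - y \in S).
Proof.
by rewrite -[_ \in S]/(_ \in submod_zmod_pred) Quotient.idealrBE; exact: eqP.
Qed.

Lemma quotmod_piD : {morph quotmod_pi : x y / x + y}.
Proof. by move=> x y; rewrite /quotmod_pi !piE. Qed.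

Definition quotmod_scale (a : R) (x : quotmod) : quotmod :=
  quotmod_pi (a *: quotmod_repr x).

Lemma quotmod_piZ a x : quotmod_pi (a *: x) = quotmod_scale a (quotmod_pi x).
Proof.
by apply/quotmod_eqP; rewrite -scalerBr rpredZ //; apply/quotmod_eqP;
  rewrite quotmod_reprK.
Qed.

Lemma quotmod_scaleA a b v :
  quotmod_scale a (quotmod_scale b v) = quotmod_scale (a * b) v.
Proof. by rewrite -[v]quotmod_reprK -!quotmod_piZ scalerA. Qed.

Lemma quotmod_scale1 : left_id 1 quotmod_scale.
Proof. by move=> v; rewrite -[v]quotmod_reprK -!quotmod_piZ scale1r. Qed.

Lemma quotmod_scaleDr : right_distributive quotmod_scale +%R.
Proof.
move=> a u v; rewrite -[u]quotmod_reprK -[v]quotmod_reprK.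
by rewrite -quotmod_piD -!quotmod_piZ -quotmod_piD scalerDr.
Qed.

Lemma quotmod_scaleDl v : {morph quotmod_scale^~ v : a b / a + b}.
Proof.
move=> a b; rewrite -[v]quotmod_reprK.
by rewrite -!quotmod_piZ -quotmod_piD scalerDl.
Qed.

HB.instance Definition _ := GRing.Zmodule_isLmodule.Build R quotmod
  quotmod_scaleA quotmod_scale1 quotmod_scaleDr quotmod_scaleDl.

Lemma quotmod_pi_is_linear : linear quotmod_pi.
Proof. by move=> a x y; rewrite quotmod_piD quotmod_piZ. Qed.

HB.instance Definition _ :=
  GRing.isLinear.Build R M quotmod _ quotmod_pi quotmod_pi_is_linear.

End QuotientModule.

(* The map M/S -> N/T induced by f. It is defined through representatives, and
   is the induced map as soon as f is linear and maps S into T. *)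
Definition quotmod_map (R : nzRingType) (M N : lmodType R)
    (S : submodClosed M) (T : submodClosed N) (f : M -> N)
    (x : quotmod S) : quotmod T :=
  quotmod_pi T (f (quotmod_repr x)).

Lemma quotmod_map_pi (R : nzRingType) (M N : lmodType R)
    (S : submodClosed M) (T : submodClosed N) (f : {linear M -> N}) :
  {in S, forall x, f x \in T} ->
  forall x, quotmod_map T f (quotmod_pi S x) = quotmod_pi T (f x).
Proof.
move=> fST x; apply/quotmod_eqP; rewrite -linearB fST //.
by apply/quotmod_eqP; rewrite quotmod_reprK.
Qed.

Lemma quotmod_map_linear (R : nzRingType) (M N : lmodType R)
    (S : submodClosed M) (T : submodClosed N) (f : {linear M -> N}) :
  {in S, forall x, f x \in T} -> linear (quotmod_map T f : quotmod S -> _).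
Proof.
move=> fST a x y; rewrite -[x]quotmod_reprK -[y]quotmod_reprK -linearP.
by rewrite !quotmod_map_pi // !linearP.
Qed.

Section ScaledSubmodule.
Context (R : comNzRingType) (r : R) (M : lmodType R).

Definition scaled_pred : {pred M} := fun x => `[< exists y, x = r *: y >].

Lemma scaled_pred_submod : subsemimod_closed scaled_pred.
Proof.
split; first split.
- by apply/asboolP; exists 0; rewrite scaler0.
- move=> _ _ /asboolP[x ->] /asboolP[y ->]; apply/asboolP.
  by exists (x + y); rewrite scalerDr.
- move=> a _ /asboolP[x ->]; apply/asboolP.
  by exists (a *: x); rewrite !scalerA mulrC.
Qed.

HB.instance Definition _ :=
  GRing.isSubmodClosed.Build R M scaled_pred scaled_pred_submod.

End ScaledSubmodule.

Arguments scaled_pred {R} r M _ : assert.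

(* M / rM *)
Notation modred r M := (quotmod (scaled_pred r M)).

Section ReducedMap.
Context (R : comNzRingType) (r : R) (M N : lmodType R) (f : {linear M -> N}).

Lemma scaled_pred_map : {in scaled_pred r M, forall x, f x \in scaled_pred r N}.
Proof.
by move=> _ /asboolP[y ->]; apply/asboolP; exists (f y); rewrite linearZ.
Qed.

Definition modred_map : modred r M -> modred r N :=
  quotmod_map (scaled_pred r N) f.

Lemma modred_map_pi x :
  modred_map (quotmod_pi _ x) = quotmod_pi (scaled_pred r N) (f x).
Proof. exact: quotmod_map_pi scaled_pred_map x. Qed.

HB.instance Definition _ := GRing.isLinear.Build R (modred r M) (modred r N) _
  modred_map (quotmod_map_linear scaled_pred_map).

End ReducedMap.

Arguments modred_map {R} r {M N} f _ : assert.

Section GeneratedSubmodule.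
Context (R : nzRingType) (M : lmodType R) (G : set M).

Definition generated_pred : {pred M} := fun x =>
  `[< forall S : submodClosed M, (forall y, G y -> y \in S) -> x \in S >].

Lemma generated_pred_submod : subsemimod_closed generated_pred.
Proof.
split; first split.
- by apply/asboolP => S _; exact: rpred0.
- move=> x y /asboolP xG /asboolP yG; apply/asboolP => S GS.
  by rewrite rpredD ?xG ?yG.
- by move=> a x /asboolP xG; apply/asboolP => S GS; rewrite rpredZ ?xG.
Qed.

HB.instance Definition _ :=
  GRing.isSubmodClosed.Build R M generated_pred generated_pred_submod.

Lemma generated_sub y : G y -> y \in generated_pred.
Proof. by move=> Gy; apply/asboolP => S; exact. Qed.

End GeneratedSubmodule.

(* M ⊗_R N is the free R-module on M × N modulo the bilinearity relations. *)
Section Tensor.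
Context (R : comNzRingType) (M N : lmodType R).

Definition tens_free := {freeg (M * N)%type / R}.

Inductive tens_rel : tens_free -> Prop :=
| tens_relDl m m' n :
    tens_rel (<< (m + m', n) >> - << (m, n) >> - << (m', n) >>)
| tens_relDr m n n' :
    tens_rel (<< (m, n + n') >> - << (m, n) >> - << (m, n') >>)
| tens_relZl a m n : tens_rel (<< (a *: m, n) >> - a *: << (m, n) >>)
| tens_relZr a m n : tens_rel (<< (m, a *: n) >> - a *: << (m, n) >>).

Definition tens : Type := quotmod (generated_pred tens_rel).
HB.instance Definition _ := GRing.Lmodule.on tens.

Definition tensor (m : M) (n : N) : tens :=
  quotmod_pi (generated_pred tens_rel) << (m, n) >>.

Let relE u v : u - v \in generated_pred tens_rel ->
  quotmod_pi (generated_pred tens_rel) u = quotmod_pi _ v.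
Proof. by move/quotmod_eqP. Qed.

Lemma tensorDl n : {morph tensor^~ n : m m' / m + m'}.
Proof.
move=> m m'; rewrite /tensor -linearD; apply: relE.
by rewrite opprD addrA; apply: generated_sub; exact: tens_relDl.
Qed.

Lemma tensorDr m : {morph tensor m : n n' / n + n'}.
Proof.
move=> n n'; rewrite /tensor -linearD; apply: relE.
by rewrite opprD addrA; apply: generated_sub; exact: tens_relDr.
Qed.

Lemma tensorZl a m n : tensor (a *: m) n = a *: tensor m n.
Proof.
by rewrite /tensor -linearZ; apply: relE; apply: generated_sub; exact: tens_relZl.
Qed.

Lemma tensorZr a m n : tensor m (a *: n) = a *: tensor m n.
Proof.
by rewrite /tensor -linearZ; apply: relE; apply: generated_sub; exact: tens_relZr.
Qed.

End Tensor.

Section FreeLift.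
Context (R : nzRingType) (K : choiceType) (M : lmodType R) (f : K -> M).

Definition free_lift : {freeg K / R} -> M := fglift f.

Lemma free_lift_is_linear : linear free_lift.
Proof.
have liftB : {morph free_lift : x y / x - y} := lift_is_additive f.
have lift0 : free_lift 0 = 0 by rewrite -(subrr 0) liftB subrr.
have liftN x : free_lift (- x) = - free_lift x.
  by rewrite -[- x]add0r liftB lift0 add0r.
have liftD : {morph free_lift : x y / x + y}.
  by move=> x y; rewrite -{1}[y]opprK liftB liftN opprK.
have liftS (I : Type) (s : seq I) F :
    free_lift (\sum_(i <- s) F i) = \sum_(i <- s) free_lift (F i).
  exact: (big_morph free_lift liftD lift0).
move=> a x y; rewrite liftD; congr (_ + _).
rewrite -{2}[x]freeg_sumE [a *: x]/(fgscale a x) /fgscale !liftS scaler_sumr.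
by apply: eq_bigr => i _; rewrite /free_lift !liftU scalerA.
Qed.

HB.instance Definition _ := GRing.isLinear.Build R {freeg K / R} M _
  free_lift free_lift_is_linear.

Lemma free_liftU x : free_lift << x >> = f x.
Proof. by rewrite /free_lift liftU scale1r. Qed.

End FreeLift.

Section TensorMap.
Context (R : comNzRingType) (M M' N N' : lmodType R).
Context (f : {linear M -> M'}) (g : {linear N -> N'}).

Definition tens_free_map : tens_free M N -> tens_free M' N' :=
  free_lift (fun mn : M * N => << (f mn.1, g mn.2) >> : tens_free M' N').

HB.instance Definition _ := GRing.Linear.on tens_free_map.

Lemma tens_free_mapU m n : tens_free_map << (m, n) >> = << (f m, g n) >>.
Proof. by rewrite /tens_free_map free_liftU. Qed.

Lemma tens_free_map_rel :
  {in generated_pred (@tens_rel R M N), forall x,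
     tens_free_map x \in generated_pred (@tens_rel R M' N')}.
Proof.
pose T := generated_pred (@tens_rel R M' N').
pose P : {pred tens_free M N} := fun x => tens_free_map x \in T.
have Pclosed : subsemimod_closed P.
  split; first split.
  - by rewrite unfold_in /P linear0 rpred0.
  - by move=> x y xP yP; rewrite unfold_in /P linearD rpredD.
  - by move=> a x xP; rewrite unfold_in /P linearZ rpredZ.
pose PC := GRing.isSubmodClosed.Build R _ P Pclosed.
pose PS : submodClosed (tens_free M N) := HB.pack P PC.
move=> x /asboolP /(_ PS); apply=> {x} x xrel; rewrite unfold_in /= /P.
case: xrel => {x} [m m' n|m n n'|a m n|a m n].
- rewrite !linearB /= !tens_free_mapU linearD.
  by apply: generated_sub; exact: tens_relDl.
- rewrite !linearB /= !tens_free_mapU linearD.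
  by apply: generated_sub; exact: tens_relDr.
- rewrite linearB linearZ /= !tens_free_mapU linearZ.
  by apply: generated_sub; exact: tens_relZl.
- rewrite linearB linearZ /= !tens_free_mapU linearZ.
  by apply: generated_sub; exact: tens_relZr.
Qed.

(* f ⊗ g *)
Definition tens_map : tens M N -> tens M' N' :=
  quotmod_map (generated_pred (@tens_rel R M' N')) tens_free_map.

HB.instance Definition _ := GRing.isLinear.Build R (tens M N) (tens M' N') _
  tens_map (quotmod_map_linear tens_free_map_rel).

Lemma tens_mapE m n : tens_map (tensor m n) = tensor (f m) (g n).
Proof.
rewrite /tens_map /tensor (quotmod_map_pi tens_free_map_rel).
by rewrite /= tens_free_mapU.
Qed.

End TensorMap.

Section TensorUniversal.
Context (R : comNzRingType) (M N P : lmodType R) (b : M -> N -> P).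
Context (bl : forall n, linear (b^~ n)) (br : forall m, linear (b m)).

Let bDl m m' n : b (m + m') n = b m n + b m' n.
Proof. by have := bl n 1 m m'; rewrite !scale1r. Qed.

Let bDr m n n' : b m (n + n') = b m n + b m n'.
Proof. by have := br m 1 n n'; rewrite !scale1r. Qed.

Let bZl a m n : b (a *: m) n = a *: b m n.
Proof.
have b0 : b 0 n = 0 by apply: (addrI (b 0 n)); rewrite -bDl !addr0.
by have := bl n a m 0; rewrite !addr0 b0 addr0.
Qed.

Let bZr a m n : b m (a *: n) = a *: b m n.
Proof.
have b0 : b m 0 = 0 by apply: (addrI (b m 0)); rewrite -bDr !addr0.
by have := br m a n 0; rewrite !addr0 b0 addr0.
Qed.

Let lift : {linear tens_free M N -> P} :=
  free_lift (fun mn : M * N => b mn.1 mn.2).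

Let liftU m n : lift << (m, n) >> = b m n.
Proof. by rewrite /lift /= free_liftU. Qed.

Let lift_rel :
  {in generated_pred (@tens_rel R M N), forall x, lift x = 0}.
Proof.
pose Q : {pred tens_free M N} := fun x => lift x == 0.
have Qclosed : subsemimod_closed Q.
  split; first split.
  - by rewrite unfold_in /Q linear0.
  - by move=> x y /eqP xQ /eqP yQ; rewrite unfold_in /Q linearD xQ yQ addr0.
  - by move=> a x /eqP xQ; rewrite unfold_in /Q linearZ /= xQ scaler0.
pose QC := GRing.isSubmodClosed.Build R _ Q Qclosed.
pose QS : submodClosed (tens_free M N) := HB.pack Q QC.
move=> x /asboolP /(_ QS) h; apply/eqP; apply: h => {x} x xrel.
rewrite unfold_in /= /Q; apply/eqP.
case: xrel => {x} [m m' n|m n n'|a m n|a m n].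
- by rewrite !linearB !liftU bDl addrAC addrK subrr.
- by rewrite !linearB !liftU bDr addrAC addrK subrr.
- by rewrite linearB linearZ !liftU bZl subrr.
- by rewrite linearB linearZ !liftU bZr subrr.
Qed.

Lemma tens_universal :
  exists2 h : {linear tens M N -> P},
    forall m n, h (tensor m n) = b m n &
    forall h' : {linear tens M N -> P},
      (forall m n, h' (tensor m n) = b m n) -> h' =1 h.
Proof.
pose G := generated_pred (@tens_rel R M N).
pose h (x : tens M N) : P := lift (quotmod_repr x).
have hpi x : h (quotmod_pi G x) = lift x.
  apply/eqP; rewrite -subr_eq0 -linearB lift_rel //.
  by apply/quotmod_eqP; rewrite quotmod_reprK.
have hlin : linear h.
  move=> a x y; rewrite -[x]quotmod_reprK -[y]quotmod_reprK -linearP.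
  by rewrite !hpi linearP.
pose hL : {linear tens M N -> P} :=
  HB.pack h (GRing.isLinear.Build R (tens M N) P _ h hlin).
have hT m n : hL (tensor m n) = b m n by rewrite /= hpi liftU.
exists hL => // h' h'T x; rewrite -[x]quotmod_reprK.
rewrite -[quotmod_repr x]freeg_sumE !linear_sum; apply: eq_bigr => -[m n] _.
set c := coeff _ _.
have -> : << c *g (m, n) >> = c *: << (m, n) >> :> tens_free M N.
  apply/eqP/freeg_eqP => y; rewrite coeffZ !coeffU; case: eqP => _ //=.
  - by rewrite !mulr1.
  - by rewrite !mulr0.
by rewrite !linearZ -/(tensor m n) h'T hT.
Qed.

End TensorUniversal.

Definition exact_at (U V W : zmodType) (f : U -> V) (g : V -> W) : Prop :=
  forall v, g v = 0 <-> exists u, f u = v.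

Definition torsionfree (R : comNzRingType) (M : lmodType R) : Prop :=
  forall (r : R) (x : M), r *: x = 0 -> r = 0 \/ x = 0.

Definition finitely_generated (R : nzRingType) (M : lmodType R)
    (S : submodClosed M) : Prop :=
  exists (n : nat) (g : 'I_n -> M), (forall i, g i \in S) /\
    (forall x, x \in S -> exists c : 'I_n -> R, x = \sum_(i < n) c i *: g i).

(* M is the (internal) direct sum of the submodules M_ j *)
Definition direct_sum_decomposition (R : nzRingType) (M : lmodType R)
    (J : choiceType) (M_ : J -> submodClosed M) : Prop :=
  forall x : M, exists! f : J -> M,
    [/\ forall j, f j \in M_ j,
        finite_set [set j | f j != 0]%classic
      & x = \sum_(j \in [set: J]%classic) f j].

(* Main.v *)
(* Write t = q - 1. An element b of ker psi lying in B_j has the form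
   phi a + t b' with b' again in ker psi and B_j, since C has no t-torsion.
   As B_j is finitely generated and the powers of t intersect in 0 in R, this
   forces b to be torsion modulo the image of phi, so that k ⊗ b lies in the
   image of id ⊗ phi. By flatness of k over R, ker psi generates the kernel of
   id ⊗ psi. Noetherianity is avoided: both finiteness and flatness are reduced
   to the existence, by Zorn's lemma, of R-linear maps to k which vanish on a
   submodule and equal 1 at a vector that is not torsion modulo it. *)

Require Import Defs.
From HB Require Import structures.
From mathcomp Require Import all_boot all_algebra.
From mathcomp Require Import ring.
From mathcomp Require Import boolp classical_sets cardinality fsbigop freeg.

Set Implicit Arguments.
Unset Strict Implicit.
Unset Printing Implicit Defensive.

Import GRing.Theory.
Local Open Scope ring_scope.

(** * Direct sum decompositions and their projections *)

Lemma fsum_seq (V : nmodType) (J : choiceType) (f : J -> V) (r : seq J) :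
  uniq r -> (forall j, f j != 0 -> j \in r) ->
  \sum_(j \in [set: J]%classic) f j = \sum_(j <- r) f j.
Proof.
move=> ur fr; rewrite (fsbigE r) //; first by apply: eq_bigl => j; exact: mem_set.
by move=> j _; apply: contraNeq; exact: fr.
Qed.

Section Projections.
Context (R : nzRingType) (J : choiceType).

(** The list [r] may exceed the support of [f], so that two decompositions can be put over one
    common list. *)
Definition decomposes (M : lmodType R) (M_ : J -> submodClosed M)
    (x : M) (f : J -> M) (r : seq J) :=
  [/\ uniq r, forall j, f j \in M_ j, forall j, f j != 0 -> j \in r
    & x = \sum_(j <- r) f j].

Lemma decomposes_widen (M : lmodType R) (M_ : J -> submodClosed M) x f r r' :
  decomposes M_ x f r -> uniq r' -> {subset r <= r'} -> decomposes M_ x f r'.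
Proof.
move=> [ur fM fr ->] ur' sub; have fr' j : f j != 0 -> j \in r' by move/fr/sub.
by split; rewrite // -(fsum_seq ur fr) (fsum_seq ur' fr').
Qed.

Definition projections (M : lmodType R) (M_ : J -> submodClosed M)
    (pr : J -> M -> M) :=
  (forall x, exists r, decomposes M_ x (pr^~ x) r) /\
  (forall x f r, decomposes M_ x f r -> f =1 pr^~ x).

Lemma projections_exist (M : lmodType R) (M_ : J -> submodClosed M) :
  direct_sum_decomposition M_ -> exists pr, projections M_ pr.
Proof.
move=> /choice[pr prP]; exists (fun j x => pr x j).
split=> [x|x f r [ur fM fr xE] j].
  have [[prM fin xE] _] := prP x.
  have /finite_seqP[r rE] := fin.
  have suppP j : pr x j != 0 -> j \in undup r.
    by move=> nz; rewrite mem_undup; have : [set` r]%classic j by rewrite -rE.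
  exists (undup r); split=> //; first exact: undup_uniq.
  by rewrite {1}xE (fsum_seq _ suppP) // undup_uniq.
suff -> : pr x = f by [].
apply: (prP x).2; split=> //; last by rewrite (fsum_seq ur fr).
by apply: sub_finite_set (finite_seq r) => i /= /fr.
Qed.

Section Theory.
Context (M : lmodType R) (M_ : J -> submodClosed M) (pr : J -> M -> M).
Hypothesis prP : projections M_ pr.

Lemma projection_mem j x : pr j x \in M_ j.
Proof. by have [r []] := prP.1 x. Qed.

Lemma projection_id j x : x \in M_ j -> pr j x = x.
Proof.
move=> xM; have /prP.2 /(_ j) :
    decomposes M_ x (fun i => if i == j then x else 0) [:: j].
  split=> // [i|i|]; first by case: eqP => [->//|_]; exact: rpred0.
    by rewrite inE; case: (i == j); rewrite ?eqxx.
  by rewrite big_seq1 eqxx.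
by rewrite eqxx.
Qed.

Lemma projection_linear j : linear (pr j).
Proof.
move=> a x y; have [r rx] := prP.1 x; have [s sy] := prP.1 y.
have sub1 : {subset r <= undup (r ++ s)}.
  by move=> i; rewrite mem_undup mem_cat => ->.
have sub2 : {subset s <= undup (r ++ s)}.
  by move=> i; rewrite mem_undup mem_cat => ->; rewrite orbT.
have [ur xM xr xE] := decomposes_widen rx (undup_uniq _) sub1.
have [_ yM yr yE] := decomposes_widen sy (undup_uniq _) sub2.
suff /prP.2 <- : decomposes M_ (a *: x + y) (fun j => a *: pr j x + pr j y)
  (undup (r ++ s)) by [].
split=> // [i|i|]; first by rewrite rpredD ?rpredZ.
  apply: contraR => ni; rewrite (contraNeq (xr i) ni) (contraNeq (yr i) ni).
  by rewrite scaler0 addr0.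
by rewrite big_split -scaler_sumr -xE -yE.
Qed.

End Theory.

(** Applying [f] to the components of [x] decomposes [f x], and decompositions are unique. *)
Lemma projection_map (M N : lmodType R) (M_ : J -> submodClosed M)
    (N_ : J -> submodClosed N) prM prN (f : {linear M -> N}) :
  projections M_ prM -> projections N_ prN ->
  (forall j x, x \in M_ j -> f x \in N_ j) ->
  forall j x, prN j (f x) = f (prM j x).
Proof.
move=> prMP prNP fMN j x; have [r [ur xM xr xE]] := prMP.1 x.
apply/esym; apply: (prNP.2 _ (fun j => f (prM j x)) r _ j); split=> // [i|i|].
- exact: fMN.
- by apply: contraR => ni; rewrite (contraNeq (xr i) ni) linear0.
- by rewrite {1}xE linear_sum.
Qed.

End Projections.

(** * Field-valued functionals from Zorn's lemma *)

Section Functional.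
Context (R : comNzRingType) (K : fieldType) (i : {rmorphism R -> K}).
Hypothesis i_inj : injective i.
Context (M : lmodType R).

(** A bare set, because [Zorn_bigcup] orders sets by inclusion. *)
Definition submodule (X : set M) :=
  X 0 /\ forall a x y, X x -> X y -> X (a *: x + y).

(** [X] is maximal among the submodules above [S] that contain no [r *: v] with [r <> 0]. Maximality
    makes the quotient by [X + R v] a torsion module. *)
Lemma maximal_free_submodule (S : set M) (v : M) :
  submodule S -> (forall r, S (r *: v) -> r = 0) ->
  exists2 X : set M, submodule X /\ (S `<=` X)%classic &
    (forall r, X (r *: v) -> r = 0) /\
    forall m, exists a r, a <> 0 /\ X (a *: m - r *: v).
Proof.
move=> Ssub Sv.
pose good (X : set M) :=
  [/\ submodule X, (S `<=` X)%classic & forall r, X (r *: v) -> r = 0].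
(* The empty set is admitted so that the union of the empty chain qualifies. *)
have [F Fgood Fchain|X [Xgood Xmax]] :=
    @Zorn_bigcup M (fun X => X = set0 \/ good X).
  have [[Y FY Ygood]|none] := pselect (exists2 Y, F Y & good Y); last first.
    left; rewrite -subset0 => x [Y FY Yx]; case: (Fgood _ FY) => [Y0|Yg].
      by rewrite Y0 in Yx.
    by case: none; exists Y.
  right; have goodF Z x : F Z -> Z x -> good Z.
    by move=> FZ Zx; case: (Fgood _ FZ) => // Z0; rewrite Z0 in Zx.
  have [[Y0 YL] SY Yv] := Ygood; split=> [|x Sx|r [Z FZ Zr]].
  - split=> [|a x y [Z FZ Zx] [W FW Wy]]; first by exists Y.
    have [ZW|WZ] := Fchain _ _ FZ FW.
      exists W => //; have [[_ WL] _ _] := goodF _ _ FW Wy.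
      by apply: WL => //; exact: ZW.
    exists Z => //; have [[_ ZL] _ _] := goodF _ _ FZ Zx.
    by apply: ZL => //; exact: WZ.
  - by exists Y; last exact: SY.
  - by have [_ _] := goodF _ _ FZ Zr; apply.
(* The empty set is not maximal, since [S] is good and contains 0. *)
have {Xgood} [[X0 XL] SX Xv] : good X.
  case: Xgood => // X0; have XS : (X `<` S)%classic.
    by rewrite X0; split=> [x []|/(_ 0 Ssub.1)].
  by case: (Xmax _ XS); right; split.
exists X => //; split=> // m.
have XZ a x : X x -> X (a *: x) by move=> Xx; rewrite -[_ *: _]addr0; exact: XL.
have [Xm|nXm] := pselect (X m).
  exists 1, 0; split; first by apply/eqP; exact: oner_neq0.
  by rewrite scale1r scale0r subr0.
have [//|none] := pselect (exists a r, a <> 0 /\ X (a *: m - r *: v)).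
(* Without such [a] and [r], the submodule [X + R m] would be good too: a relation [r v = x + a m]
   with [a <> 0] would put [a m - r v] in [X]. *)
pose Y := [set x + a *: m | x in X & a in [set: R]]%classic.
have XY : (X `<` Y)%classic.
  split=> [x Xx|YX].
    by exists x => //; exists 0 => //; rewrite scale0r addr0.
  by apply/nXm/YX; exists 0 => //; exists 1 => //; rewrite add0r scale1r.
case: (Xmax _ XY); right; split.
- split=> [|a _ _ [x Xx [b _ <-]] [y Xy [c _ <-]]].
    by exists 0 => //; exists 0 => //; rewrite scale0r addr0.
  exists (a *: x + y); first exact: XL.
  exists (a * b + c) => //.
  by rewrite scalerDr scalerDl scalerA addrACA.
- move=> x /SX Xx; exists x => //; exists 0 => //.
  by rewrite scale0r addr0.
- move=> r [x Xx [a _ E]]; have [a0|nza] := eqVneq a 0.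
    by apply: Xv; rewrite -E a0 scale0r addr0.
  case: none; exists a, r; split; first exact/eqP.
  by rewrite -E opprD addrCA subrr addr0 -scaleN1r; exact: XZ.
Qed.

(* With X as in [maximal_free_submodule], f m is the ratio r / a for any a <> 0
   and r such that a m - r v lies in X. *)
Lemma functional (S : set M) (v : M) :
  submodule S -> (forall r, S (r *: v) -> r = 0) ->
  exists f : M -> K,
    [/\ forall a x y, f (a *: x + y) = i a * f x + f y,
        forall x, S x -> f x = 0, f v = 1 &
        forall x, exists a r, a <> 0 /\ i a * f x = i r].
Proof.
move=> Ssub Sv.
have [X [[X0 XL] SX] [Xv Xtot]] := maximal_free_submodule Ssub Sv.
have XZ a x : X x -> X (a *: x) by move=> Xx; rewrite -[_ *: _]addr0; exact: XL.
have iN0 a : a <> 0 -> i a != 0.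
  by move=> a0; apply/eqP; rewrite -(rmorph0 i) => /i_inj.
(* The ratio r / a depends on [m] only: eliminating [m] from the two memberships puts
   [(a s - b r) v] in [X]. *)
have uniq m a r b s : X (a *: m - r *: v) -> X (b *: m - s *: v) ->
    i a * i s = i b * i r.
  move=> Xa Xb; have : X ((a * s - b * r) *: v).
    have := XL b _ _ Xa (XZ (- a) _ Xb); rewrite !scalerBr !scalerA.
    rewrite addrACA -scalerDl mulrC mulNr subrr scale0r add0r.
    by rewrite mulNr scaleNr opprK addrC -scalerBl.
  by move=> /Xv/eqP; rewrite subr_eq0 -!rmorphM => /eqP ->.
have /choice[f fP] : forall m, exists y : K, exists a r,
    [/\ a <> 0, X (a *: m - r *: v) & i a * y = i r].
  move=> m; have [a [r [a0 Xar]]] := Xtot m.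
  by exists (i r / i a), a, r; split; rewrite // mulrC divfK ?iN0.
have fE m a r : a <> 0 -> X (a *: m - r *: v) -> i a * f m = i r.
  move=> a0 Xa; have [b [s [b0 Xb fb]]] := fP m.
  apply: (mulfI (iN0 _ b0)); rewrite -(uniq _ _ _ _ _ Xa Xb).
  by rewrite mulrCA fb.
have one0 : (1 : R) <> 0 by apply/eqP; exact: oner_neq0.
exists f; split=> [c x y|x Sx||x].
- have [a [r [a0 Xa fa]]] := fP x; have [b [s [b0 Xb fb]]] := fP y.
  have ab0 : a * b <> 0.
    move=> ab0; move: (mulf_neq0 (iN0 _ a0) (iN0 _ b0)).
    by rewrite -rmorphM ab0 rmorph0 eqxx.
  apply: (mulfI (iN0 _ ab0)).
  (* With f x = r / a and f y = s / b, this is c r / a + s / b over the denominator a b. *)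
  rewrite (fE (c *: x + y) (a * b) (b * c * r + a * s)) //; last first.
    have := XL (b * c) _ _ Xa (XZ a _ Xb); rewrite !scalerBr !scalerDr !scalerA.
    by rewrite addrACA -opprD -scalerDl [b * c * a]mulrC [a * (b * c)]mulrA.
  rewrite rmorphD !rmorphM mulrDr -fa -fb; congr (_ + _).
    by rewrite mulrCA !mulrA; congr (_ * _); rewrite mulrAC [i c * _]mulrC mulrAC.
  by rewrite mulrA.
- have := @fE x 1 0 one0; rewrite scale1r scale0r subr0 rmorph1 mul1r rmorph0.
  by apply; exact: SX.
- have := @fE v 1 1 one0; rewrite subrr rmorph1 mul1r.
  by apply.
- by have [a [r [? _ ?]]] := fP x; exists a, r.
Qed.

End Functional.

(** * Common denominators on finitely generated submodules *)

Section CommonDenominator.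
Context (R : comNzRingType) (K : fieldType) (i : {rmorphism R -> K}).
Hypothesis i_inj : injective i.
Context (M : lmodType R) (f : M -> K).
Hypothesis f_lin : forall a x y, f (a *: x + y) = i a * f x + f y.
Hypothesis f_frac : forall x, exists a r, a <> 0 /\ i a * f x = i r.

(** The product of the denominators of [f] at the generators serves as [d]. *)
Lemma common_denominator (S : submodClosed M) : finitely_generated S ->
  exists2 d, d <> 0 & forall x, x \in S -> exists r, i d * f x = i r.
Proof.
move=> [n [g [_ gS]]].
have /choice[a /choice[r ar]] := fun j => f_frac (g j).
exists (\prod_j a j) => [|x /gS[c ->]].
  move=> a0; have : i (\prod_j a j) != 0.
    rewrite rmorph_prod; apply/prodf_neq0 => j _; apply/eqP.
    by rewrite -(rmorph0 i) => /i_inj; exact: (ar j).1.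
  by rewrite a0 rmorph0 eqxx.
have f0 : f 0 = 0.
  by have := f_lin (-1) 0 0; rewrite scaler0 addr0 rmorphN1 mulN1r addNr.
have -> : f (\sum_j c j *: g j) = \sum_j i (c j) * f (g j).
  by elim/big_rec2: _ => // j z w _ <-; exact: f_lin.
exists (\sum_j (\prod_(l | l != j) a l) * c j * r j).
rewrite mulr_sumr rmorph_sum; apply: eq_bigr => j _.
rewrite (bigD1 j) //= !rmorphM /= -(ar j).2; ring.
Qed.

End CommonDenominator.

(** * Finite sums of pure tensors *)

Section TensorSums.
Context (R : comNzRingType) (M N : lmodType R).

Lemma tensor0l (n : N) : tensor (0 : M) n = 0.
Proof. by rewrite -(scale0r 0) tensorZl scale0r. Qed.

Lemma tensor0r (m : M) : tensor m (0 : N) = 0.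
Proof. by rewrite -(scale0r 0) tensorZr scale0r. Qed.

Lemma tensorNl (m : M) (n : N) : tensor (- m) n = - tensor m n.
Proof. by rewrite -scaleN1r tensorZl scaleN1r. Qed.

Lemma tensorNr (m : M) (n : N) : tensor m (- n) = - tensor m n.
Proof. by rewrite -scaleN1r tensorZr scaleN1r. Qed.

Lemma tensor_suml (I : Type) (r : seq I) (F : I -> M) (n : N) :
  tensor (\sum_(i <- r) F i) n = \sum_(i <- r) tensor (F i) n.
Proof. exact: (big_morph (fun m => tensor m n) (tensorDl n) (tensor0l n)). Qed.

Lemma tensor_sumr (I : Type) (r : seq I) (m : M) (F : I -> N) :
  tensor m (\sum_(i <- r) F i) = \sum_(i <- r) tensor m (F i).
Proof. exact: (big_morph (tensor m) (tensorDr m) (tensor0r m)). Qed.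

(** A representative in the free module is a finite combination of pairs; each coefficient is
    absorbed into the left factor. *)
Lemma tensor_span (x : tens M N) :
  exists n (c : 'I_n -> M) (b : 'I_n -> N), x = \sum_i tensor (c i) (b i).
Proof.
rewrite -[x]quotmod_reprK -[quotmod_repr x]freeg_sumE linear_sum.
set r := dom _; rewrite big_tnth; set D := quotmod_repr x.
exists (size r), (fun i => coeff (tnth (in_tuple r) i) D *:
                             (tnth (in_tuple r) i).1),
  (fun i => (tnth (in_tuple r) i).2).
apply: eq_bigr => i _; rewrite tensorZl; case: (tnth _ _) => m n /=.
rewrite /tensor -linearZ; congr quotmod_pi.
apply/eqP/freeg_eqP => y; rewrite coeffZ !coeffU; case: eqP => _ //=.
- by rewrite !mulr1.
- by rewrite !mulr0.
Qed.

End TensorSums.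

(** * Tensoring with k over the Laurent ring; flatness *)

Section ScalarExtensionTensor.
Context (k0 k : fieldType) (iota : {rmorphism k0 -> k}) (q : k).

Local Notation R := (laurent iota q).
Local Notation K := (scalar_ext iota q).

Definition laurent_val : R -> k := val.
HB.instance Definition _ := GRing.RMorphism.on laurent_val.

Lemma laurent_val_inj : injective laurent_val.
Proof. exact: val_inj. Qed.

Lemma scalar_extE (r : R) (x : K) : r *: x = (laurent_val r * (x : k) : k).
Proof. by []. Qed.

Definition independent n (e : 'I_n -> K) :=
  forall r : 'I_n -> R, \sum_i r i *: e i = 0 -> forall i, r i = 0.

Lemma scalar_ext_divisible (r : R) (x : K) : r <> 0 -> exists y : K, x = r *: y.
Proof.
move=> r0; exists ((x : k) / laurent_val r : k); rewrite scalar_extE mulrC.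
rewrite divfK //; apply/eqP; rewrite -(rmorph0 laurent_val) => /laurent_val_inj.
exact: r0.
Qed.

Section Module.
Context (M : lmodType R).

(* A relation among the left factors lets one of them be eliminated, so a shortest
   expression as a sum of pure tensors has independent left factors. *)
Lemma tensor_independent (x : tens K M) :
  exists n (e : 'I_n -> K) (b : 'I_n -> M),
    independent e /\ x = \sum_i tensor (e i) (b i).
Proof.
have [n [c [b ->]]] := tensor_span x; elim: n c b {x} => [|n IHn] c b.
  by exists 0, c, b; split=> // r _ [].
have [ind|/existsNP[r /not_implyP[rc0 /existsNP[l rl0]]]] :=
  pselect (independent c); first by exists n.+1, c, b.
have /choice[c' c'E] := fun j => scalar_ext_divisible (c (fintype.lift l j)) rl0.
have [c0 c0E] := scalar_ext_divisible (c l) rl0.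
(* The relation is solved for [c l] by dividing it by [r l] in the field. *)
have cl : c l = - \sum_j r (fintype.lift l j) *: c' j.
  have inj : injective (fun z : K => r l *: z).
    move=> y z; rewrite !scalar_extE; apply: mulfI; apply/eqP.
    by rewrite -(rmorph0 laurent_val) => /laurent_val_inj.
  apply: inj; move: rc0; rewrite (bigD1_ord l) //= => /eqP.
  rewrite addr_eq0 => /eqP ->; rewrite scalerN scaler_sumr; congr (- _).
  by apply: eq_bigr => j _; rewrite scalerA mulrC -scalerA -c'E.
(* Substituting for [c l] leaves [n] pure tensors, to which the induction hypothesis applies. *)
suff -> : \sum_i tensor (c i) (b i) =
    \sum_j tensor (c' j) (r l *: b (fintype.lift l j) - r (fintype.lift l j) *: b l).
  exact: IHn.
rewrite (bigD1_ord l) //= cl tensorNl tensor_suml -sumrN -big_split /=.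
apply: eq_bigr => j _; rewrite tensorDr tensorNr !tensorZr addrC.
by rewrite c'E !tensorZl.
Qed.

(* Flatness of k, by testing against the bilinear maps (c, z) |-> lam c * mu z
   with lam dual to the e i and mu nonzero at a given y l. *)
Lemma tensor_independent_eq0 n (e : 'I_n -> K) (y : 'I_n -> M) :
  torsionfree M -> independent e -> \sum_i tensor (e i) (y i) = 0 ->
  forall i, y i = 0.
Proof.
move=> Mtf ind ey0 l; apply/eqP; apply/negP => /negP/eqP yl0.
(* The span of the [e i] with [i <> l]; thus [lam] is 1 at [e l] and 0 at the other [e i]. *)
pose S := [set x : K | exists c : 'I_n -> R, c l = 0 /\ x = \sum_i c i *: e i]%classic.
have [||lam [lamL lamS lam1 _]] := @functional _ _ _ laurent_val_inj K S (e l).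
- split=> [|a _ _ [c [cl ->]] [d [dl ->]]].
    by exists (fun=> 0); split=> //; rewrite big1 // => i _; rewrite scale0r.
  exists (fun i => a * c i + d i); split; first by rewrite cl dl mulr0 addr0.
  rewrite scaler_sumr -big_split; apply: eq_bigr => i _ /=.
  by rewrite scalerDl scalerA.
- move=> r [c [cl E]]; suff : r - c l = 0 by rewrite cl subr0.
  have := ind (fun i => (if i == l then r else 0) - c i); move/(_ _ l).
  rewrite eqxx; apply.
  under eq_bigr do rewrite scalerBl; rewrite sumrB -E (bigD1 l) //= eqxx.
  rewrite big1 ?addr0 ?subrr // => i /negPf ->; exact: scale0r.
have [||mu [muL _ mu1 _]] :=
    @functional _ _ _ laurent_val_inj M [set 0]%classic (y l).
- by split=> [|a _ _ -> ->] //=; rewrite scaler0 addr0.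
- by move=> r /Mtf[].
have [h hE _] := @tens_universal R K M K (fun c z => lam c * mu z : k)
  (fun z a c d => etrans (congr1 (fun u => u * mu z) (lamL a c d))
     (etrans (mulrDl _ _ _) (congr1 (fun u => u + _) (esym (mulrA _ _ _)))))
  (fun c a z w => etrans (congr1 (fun u => lam c * u) (muL a z w))
     (etrans (mulrDr _ _ _) (congr1 (fun u => u + _) (mulrCA _ _ _)))).
(* Only the term at [l] survives under [h], and its value is 1. *)
have := congr1 h ey0; rewrite linear_sum linear0 (bigD1 l) //= big1; last first.
  move=> i il; rewrite hE lamS ?mul0r //.
  exists (fun j => (j == i)%:R); rewrite eq_sym (negPf il); split=> //.
  rewrite (bigD1 i) //= eqxx scale1r big1 ?addr0 // => j /negPf ->.
  exact: scale0r.
by rewrite addr0 hE lam1 mu1 mulr1 => /eqP; rewrite oner_eq0.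
Qed.

End Module.

End ScalarExtensionTensor.

(** * Powers of t = q - 1 and torsion of the kernel modulo the image *)

Section Main.
Context (k0 k : fieldType) (iota : {rmorphism k0 -> k}) (q : k).
Hypothesis q_transcendental : ~ algebraicOver iota q.

Local Notation R := (laurent iota q).
Local Notation K := (scalar_ext iota q).
Local Notation t := (laurent_q iota q - 1).
Local Notation val := (@laurent_val k0 k iota q).

(** Carries identities in [k] back to polynomials, where divisibility can be used. *)
Lemma transcendental_inj (p r : {poly k0}) :
  (map_poly iota p).[q] = (map_poly iota r).[q] -> p = r.
Proof.
move=> E; apply/eqP; rewrite -subr_eq0; apply/negP => /negP pr.
apply: q_transcendental; exists (p - r) => //.
by rewrite rootE rmorphB hornerD hornerN E subrr.
Qed.

Lemma transcendental_neq0 : q != 0.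
Proof.
apply/eqP => q0; have := @transcendental_inj 'X 0.
rewrite map_polyX hornerX rmorph0 horner0 => /(_ q0) /eqP.
by rewrite polyX_eq0.
Qed.

Lemma laurent_valE (x : R) : exists p n, val x = (map_poly iota p).[q] / q ^+ n.
Proof. by have /asboolP := valP x. Qed.

Lemma laurent_t_neq0 : t <> 0.
Proof.
move=> /(congr1 val); rewrite rmorphB rmorph1 rmorph0 => /eqP.
rewrite subr_eq0 => /eqP q1; have := @transcendental_inj 'X 1.
rewrite map_polyX hornerX rmorph1 hornerC => /(_ q1) /(congr1 (fun p : {poly k0} => size p)).
by rewrite size_polyX size_poly1.
Qed.

(** Write d = p(q) / q^m. A high power of X - 1 divides p up to a power of X; being coprime to X it
    divides p itself, so p = 0 by degree. *)
Lemma laurent_cap_t (d : R) : (forall n, exists e, d = t ^+ n * e) -> d = 0.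
Proof.
move=> dt; apply: laurent_val_inj; rewrite rmorph0.
have [p [m dE]] := laurent_valE d.
have qX0 n : q ^+ n != 0 by rewrite expf_neq0 // transcendental_neq0.
suff p0 : p = 0 by rewrite dE p0 rmorph0 horner0 mul0r.
(* The exponent [size p] exceeds the degree of [p] if [p] is nonzero. *)
have [e eE] := dt (size p); have [r [n rE]] := laurent_valE e.
have E : p * 'X^n = ('X - 1%:P) ^+ size p * r * 'X^m.
  apply: transcendental_inj; rewrite !rmorphM !rmorphXn /= map_polyX.
  rewrite map_polyXsubC rmorph1 !hornerM !horner_exp hornerX hornerXsubC.
  have := congr1 val eE; rewrite rmorphM rmorphXn rmorphB rmorph1 /= dE rE.
  rewrite -[val _]/(q) => E.
  have -> : (map_poly iota p).[q] = (map_poly iota p).[q] / q ^+ m * q ^+ m.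
    by rewrite divfK.
  by rewrite E; field.
have cop : coprimep (('X - 1%:P) ^+ size p) ('X^n : {poly k0}).
  apply/coprimep_expl/coprimep_expr.
  rewrite coprimep_sym coprimep_XsubC rootE hornerX; exact: oner_neq0.
have : ('X - 1%:P) ^+ size p %| p.
  by rewrite -(Gauss_dvdpl _ cop) E -mulrA dvdp_mulIl.
apply: contraTeq => p0; apply/negP => /(dvdp_leq p0).
by rewrite size_exp_XsubC ltnn.
Qed.

Lemma modred_exact_lift (A B C : lmodType R) (phi : {linear A -> B})
    (psi : {linear B -> C}) (b : B) :
  exact_at (modred_map t phi) (modred_map t psi) -> psi b = 0 ->
  exists a b', b = phi a + t *: b'.
Proof.
move=> ex pb.
have /(ex _).1[u] : modred_map t psi (quotmod_pi _ b) = 0.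
  by rewrite modred_map_pi pb linear0.
rewrite -[u]quotmod_reprK modred_map_pi => /quotmod_eqP/asboolP[y yE].
exists (quotmod_repr u), (- y).
by rewrite scalerN -yE opprB addrC subrK.
Qed.

(* If b were not torsion modulo the image of phi, a Frac(R)-valued functional f
   would kill that image with f b = 1. Iterating b = phi a + t b' yields
   f b = t^n f b_n with b_n in S, so a common denominator d of f on S would be
   divisible by every power of t. *)
Lemma kernel_torsion (A B C : lmodType R) (phi : {linear A -> B})
    (psi : {linear B -> C}) (S : submodClosed B) :
  finitely_generated S ->
  (forall b, b \in S -> psi b = 0 ->
     exists a b', [/\ b' \in S, psi b' = 0 & b = phi a + t *: b']) ->
  forall b, b \in S -> psi b = 0 -> exists r a, r <> 0 /\ r *: b = phi a.
Proof.
move=> Sfg step b bS pb.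
have [//|none] := pselect (exists r a, r <> 0 /\ r *: b = phi a).
have [||f [fL fphi fb ffrac]] :=
    @functional _ _ _ (@laurent_val_inj _ _ iota q) B (range phi) b.
- split=> [|a _ _ [x _ <-] [y _ <-]]; first by exists 0; rewrite ?linear0.
  by exists (a *: x + y); rewrite // linearP.
- move=> r [a _ E]; have [//|r0] := eqVneq r 0.
  by case: none; exists r, a; split; [exact/eqP | rewrite E].
have [d d0 dS] :=
  common_denominator (@laurent_val_inj _ _ iota q) fL ffrac Sfg.
case: d0; apply: laurent_cap_t => n.
have [b' [b'S _ fE]] : exists b', [/\ b' \in S, psi b' = 0 &
    f b = val (t ^+ n) * f b'].
  elim: n => [|n [b' [b'S pb' fE]]].
    by exists b; rewrite expr0 rmorph1 mul1r.
  have [a [b'' [b''S pb'' E]]] := step _ b'S pb'.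
  exists b''; split=> //; rewrite fE E [phi a + _]addrC fL (fphi (phi a)) ?addr0; last by exists a.
  by rewrite exprSr rmorphM mulrA.
(* As [f b = 1], one gets d = d t^n f b' = t^n r in the field. *)
have [r rE] := dS _ b'S; exists r; apply: laurent_val_inj.
by rewrite rmorphM -rE mulrCA -fE fb mulr1.
Qed.

End Main.

(** * Exactness after extension of scalars *)

Theorem proposition1p1
  (k0 k : fieldType) (iota : {rmorphism k0 -> k}) (q : k)
  (q_notin_k0 : forall a : k0, q <> iota a)
  (q_transcendental : ~ algebraicOver iota q)
  (A B C : lmodType (laurent iota q))
  (phi : {linear A -> B}) (psi : {linear B -> C})
  (psi_phi : forall a : A, psi (phi a) = 0)
  (C_torsionfree : torsionfree C)
  (J : choiceType)
  (A_ : J -> submodClosed A) (B_ : J -> submodClosed B)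
  (C_ : J -> submodClosed C)
  (A_sum : direct_sum_decomposition A_)
  (B_sum : direct_sum_decomposition B_)
  (C_sum : direct_sum_decomposition C_)
  (B_fg : forall j : J, finitely_generated (B_ j))
  (phi_A_B : forall (j : J) (a : A), a \in A_ j -> phi a \in B_ j)
  (psi_B_C : forall (j : J) (b : B), b \in B_ j -> psi b \in C_ j)
  (reduced_exact :
     exact_at (modred_map (laurent_q iota q - 1) phi)
              (modred_map (laurent_q iota q - 1) psi)) :
  exact_at (tens_map (@idfun (scalar_ext iota q)) phi)
           (tens_map (@idfun (scalar_ext iota q)) psi).
Proof.
have [prA prAP] := projections_exist A_sum.
have [prB prBP] := projections_exist B_sum.
have [prC prCP] := projections_exist C_sum.
have prB_phi := projection_map prAP prBP phi_A_B.
have prC_psi := projection_map prBP prCP psi_B_C.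
(* Projecting [b = phi a + t b'] to the component [j] keeps [b] and moves [b'] into [B_ j]. Then
   [t psi b' = 0], and [C] is torsionfree with [t <> 0]. *)
have ker_step j b : b \in B_ j -> psi b = 0 -> exists a b',
    [/\ b' \in B_ j, psi b' = 0 & b = phi a + (laurent_q iota q - 1) *: b'].
  move=> bB pb; have [a [b' bE]] := modred_exact_lift reduced_exact pb.
  have bE' : b = phi (prA j a) + (laurent_q iota q - 1) *: prB j b'.
    rewrite -{1}(projection_id prBP bB) bE [phi a + _]addrC (projection_linear prBP).
    by rewrite prB_phi [RHS]addrC.
  exists (prA j a), (prB j b'); split=> //; first exact: projection_mem.
  move: pb; rewrite bE' linearD linearZ psi_phi add0r => /C_torsionfree[] //.
  by move/(laurent_t_neq0 q_transcendental).
(* With [r b = phi a] and [c = r c'], the tensor of [c] and [b] equals that of [c'] and [phi a]. *)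
have im_component j b (c : scalar_ext iota q) : b \in B_ j -> psi b = 0 ->
    exists u, tens_map idfun phi u = tensor c b.
  move=> bB pb; have [r [a [r0 rE]]] :=
    kernel_torsion q_transcendental (B_fg j) (ker_step j) bB pb.
  have [c' ->] := scalar_ext_divisible c r0.
  by exists (tensor c' a); rewrite tens_mapE tensorZl -tensorZr rE.
(* Since [psi] commutes with the projections, each component of [b] lies in its kernel. *)
have im_tensor b (c : scalar_ext iota q) : psi b = 0 ->
    exists u, tens_map idfun phi u = tensor c b.
  move=> pb; have [r [_ bB _ ->]] := prBP.1 b; rewrite tensor_sumr.
  elim/big_rec: _ => [|j x _ [u ux]]; first by exists 0; rewrite linear0.
  have [|v vE] := im_component j _ c (bB j).
    by rewrite -prC_psi pb; apply: (projection_id prCP); exact: rpred0.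
  by exists (v + u); rewrite linearD /= vE ux.
move=> v; split=> [|[u <-]].
  (* With independent left factors, a zero image forces every [psi (b i)] to vanish. *)
  have [n [e [b [ind ->]]]] := tensor_independent v.
  rewrite linear_sum; under eq_bigr do rewrite /= tens_mapE.
  move=> /(tensor_independent_eq0 C_torsionfree ind) pb.
  elim/big_rec: _ => [|i x _ [u ux]]; first by exists 0; rewrite linear0.
  have [w wE] := im_tensor _ (e i) (pb i).
  by exists (w + u); rewrite linearD /= wE ux.
have [n [c [a ->]]] := tensor_span u; rewrite !linear_sum big1 // => i _ /=.
by rewrite !tens_mapE psi_phi tensor0r.
Qed.
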